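(* The vincular patterns $13\text{-}4\text{-}2$ and $31\text{-}4\text{-}2$ are Wilf-equivalent. Furthermore, this equivalence respects the last letter statistic: for all $n\ge1$ and $a\in[n]$, the number of $\pi\in\mathcal{S}_n(13\text{-}4\text{-}2)$ with $\pi_n=a$ equals the number of $\pi\in\mathcal{S}_n(31\text{-}4\text{-}2)$ with $\pi_n=a$.
   Context: A vincular pattern is a permutation $\rho\in\mathcal{S}_m$ written with dashes between some consecutive entries; $\pi\in\mathcal{S}_n$ contains it if there are indices $i_1<\cdots<i_m$ with $\pi_{i_1}\cdots\pi_{i_m}$ order-isomorphic to $\rho$ and $i_{j+1}=i_j+1$ whenever $\rho_j,\rho_{j+1}$ are not separated by a dash; otherwise $\pi$ avoids it. $\mathcal{S}_n(\rho)$ is the set of $\rho$-avoiding permutations in $\mathcal{S}_n$; patterns are Wilf-equivalent if $|\mathcal{S}_n(\rho)|=|\mathcal{S}_n(\rho')|$ for all $n\ge0$. *)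

(* Defs.v *)
From mathcomp Require Import all_boot all_fingroup.
Set Implicit Arguments.
Unset Strict Implicit.
Unset Printing Implicit Defensive.

(* Positions and letters are counted from 0, so the one-line word 1342 is
   encoded as 0231. [g \in vdashes p] means that there is a dash between the
   entries at positions [g] and [g.+1]. *)
Record vincular := Vincular {
  vsize : nat;
  vperm : 'S_vsize;
  vdashes : {set 'I_vsize.-1}
}.

Definition occurrence (p : vincular) (n : nat) (pi : 'S_n)
    (i : {ffun 'I_(vsize p) -> 'I_n}) : bool :=
  [&& [forall j : 'I_(vsize p), forall k : 'I_(vsize p),
         (j < k) ==> (i j < i k)],
      [forall j : 'I_(vsize p), forall k : 'I_(vsize p),
         (vperm p j < vperm p k) == (pi (i j) < pi (i k))]
    & [forall g : 'I_(vsize p).-1, forall j : 'I_(vsize p),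
       forall k : 'I_(vsize p),
       [&& g \notin vdashes p, j == g :> nat & k == g.+1 :> nat] ==>
       (i k == (i j).+1 :> nat)]].

Definition contains (p : vincular) (n : nat) (pi : 'S_n) : bool :=
  [exists i, occurrence (p := p) pi i].

Definition avoiders (p : vincular) (n : nat) : {set 'S_n} :=
  [set pi : 'S_n | ~~ contains p pi].

Definition wilf_equivalent (p q : vincular) : Prop :=
  forall n : nat, #|avoiders p n| = #|avoiders q n|.

Definition perm_of_word (m : nat) (w : m.-tuple 'I_m) (uniq_w : uniq w) : 'S_m :=
  perm (elimT (tuple_uniqP w) uniq_w).

Definition word1342 : 4.-tuple 'I_4 :=
  [tuple @Ordinal 4 0 isT; @Ordinal 4 2 isT; @Ordinal 4 3 isT; @Ordinal 4 1 isT].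

Definition word3142 : 4.-tuple 'I_4 :=
  [tuple @Ordinal 4 2 isT; @Ordinal 4 0 isT; @Ordinal 4 3 isT; @Ordinal 4 1 isT].

Definition last_two_gaps : {set 'I_3} :=
  [set @Ordinal 3 1 isT; @Ordinal 3 2 isT].

Definition pattern_13_4_2 : vincular :=
  @Vincular 4 (@perm_of_word 4 word1342 isT) last_two_gaps.

Definition pattern_31_4_2 : vincular :=
  @Vincular 4 (@perm_of_word 4 word3142 isT) last_two_gaps.

(* Main.v *)
Require Import Defs.
From mathcomp Require Import all_boot all_fingroup.
From mathcomp Require Import zify.
Set Implicit Arguments.
Unset Strict Implicit.
Unset Printing Implicit Defensive.

(** Write a word of distinct letters as [L m R] with [m] its largest letter.
    It avoids 13-4-2 iff [L] and [R] do and no letter [c] of [R] lies between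
    the two letters of an ascent of consecutive letters of [L] (take [m] as
    the 4).  The last condition says that the letters of [R] cut [L] into
    blocks, each of which is larger than everything after it.  Since the values of
    an occurrence in [L] then lie in one block, [L] avoids the pattern iff every
    block does.  The same holds for 31-4-2, with descents and increasing blocks.
    So transforming each block and [R] recursively and reversing the order of
    the blocks is a bijection; it keeps the last letter, because that is [m]
    or the last letter of [R]. *)

(** * Straddled pairs and avoidance for words of natural numbers *)

(* [b = true] corresponds to 13-4-2 and [b = false] to 31-4-2. *)
Definition side (b : bool) (c x : nat) : bool := if b then x < c else c < x.

(** Here [c] is a candidate for the 2, and [x], [y] are the adjacent letters: the 1 and the 3 if [b]
    holds, the 3 and the 1 otherwise. *)
Definition straddles (b : bool) (c x y : nat) : bool :=
  side b c x && side (~~ b) c y.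

(** The letter at [j] plays the 4 and the one at [k] the 2; being above the 3, the 4 is above the 2
    as well. *)
Definition avoids (b : bool) (w : seq nat) : Prop :=
  forall i j k, i.+1 < j -> j < k -> k < size w ->
    ~~ [&& straddles b (nth 0 w k) (nth 0 w i) (nth 0 w i.+1),
           nth 0 w i < nth 0 w j & nth 0 w i.+1 < nth 0 w j].

Definition unstraddled (b : bool) (c : nat) (w : seq nat) : bool :=
  sorted (fun x y => ~~ straddles b c x y) w.

Lemma side_neg (b : bool) (c x : nat) : x != c -> side (~~ b) c x = ~~ side b c x.
Proof. by rewrite /side; case: b => /=; lia. Qed.

Lemma sideNF (b : bool) (c x : nat) : side (~~ b) c x -> side b c x = false.
Proof. by rewrite /side; case: b => /=; lia. Qed.

(** At the junction the word crosses [c] in the direction opposite to that of a straddled pair, so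
    no [d] is straddled there. *)
Lemma unstraddled_cat (b : bool) (c d : nat) (u v : seq nat) :
    all (side (~~ b) c) u -> all (side b c) v ->
  unstraddled b d (u ++ v) = unstraddled b d u && unstraddled b d v.
Proof.
move=> /allP hu /allP hv; case: v hv => [|y v] hv; first by rewrite cats0 andbT.
case: u hu => [|x u] hu //.
rewrite /unstraddled /= cat_path /=.
have -> : ~~ straddles b d (last x u) y = true; last by [].
have := hu _ (mem_last x u); have := hv y (mem_head _ _).
by rewrite /straddles /side; case: b {hu hv} => /=; lia.
Qed.

Lemma all_unstraddled (b b' : bool) (c : nat) (w : seq nat) :
  all (side b' c) w -> unstraddled b c w.
Proof.
move=> /(all_nthP 0) h; apply/(sortedP 0) => i hi.
move: (h i (ltnW hi)) (h _ hi).
by rewrite /straddles /side; case: b; case: b' {h} => /=; lia.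
Qed.

(** After a letter on side [b] of [c] the next one cannot lie across [c], so all later letters stay
    on side [b]. *)
Lemma unstraddledE (b : bool) (c : nat) (w : seq nat) : c \notin w ->
  unstraddled b c w -> w = filter (side (~~ b) c) w ++ filter (side b c) w.
Proof.
elim: w => [//|x w IH]; rewrite inE negb_or eq_sym => /andP[xc cw] h.
have {IH} E := IH cw (path_sorted h).
rewrite /= side_neg //; case hx: (side b c x) => /=; last by rewrite -E.
case: w h cw E => [//|y w] /= /andP[].
rewrite /straddles hx /= => ny _.
rewrite inE negb_or eq_sym => /andP[yc cw]; move: ny; rewrite side_neg // negbK => hy.
(* If nonempty, this filter would start with [y], which is on side [b]. *)
rewrite hy /=; case F: (filter (side (~~ b) c) w) => [|z s] /= E; first by rewrite -E.
have : z \in filter (side (~~ b) c) w by rewrite F mem_head.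
by case: E => <- _; rewrite mem_filter side_neg // hy.
Qed.

(** * Avoidance in concatenations and around the largest letter *)

Lemma avoids_catl (b : bool) (u v : seq nat) : avoids b (u ++ v) -> avoids b u.
Proof.
move=> h i j k ij jk ku; have := h i j k ij jk.
rewrite size_cat !nth_cat ku.
by rewrite !(ltn_trans _ ku) // ?(ltn_trans _ jk) //; [apply; lia | lia].
Qed.

Lemma avoids_catr (b : bool) (u v : seq nat) : avoids b (u ++ v) -> avoids b v.
Proof.
move=> h i j k ij jk ku; have := h (size u + i) (size u + j) (size u + k).
have nthR t : nth 0 (u ++ v) (size u + t) = nth 0 v t.
  by rewrite nth_cat ltnNge leq_addr /= addKn.
by rewrite size_cat -addnS !nthR ltn_add2l; apply; lia.
Qed.

(** An adjacent pair across the junction goes in the wrong direction, and a letter of [v] cannot lie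
    between two letters of [u], since [c] separates it from both. So an occurrence stays inside [u]
    or [v]. *)
Lemma avoids_cat (b : bool) (c : nat) (u v : seq nat) :
    all (side (~~ b) c) u -> all (side b c) v ->
  avoids b u -> avoids b v -> avoids b (u ++ v).
Proof.
move=> /(all_nthP 0) hu /(all_nthP 0) hv au av i j k ij jk; rewrite size_cat => ks.
rewrite !nth_cat; case: (ltnP k (size u)) => ku.
  have -> : i < size u by lia. have -> : i.+1 < size u by lia.
  have -> : j < size u by lia.
  exact: au.
case: (ltnP i (size u)) => iu.
  have hk := hv (k - size u) ltac:(lia); have hi := hu _ iu.
  case: (ltnP i.+1 (size u)) => i1u.
    have hi1 := hu _ i1u; apply/negP => /and3P[+ _ _].
    move: hk hi hi1; rewrite /straddles /side.
    by case: b {hu hv au av} => /=; lia.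
  have hi1 := hv (i.+1 - size u) ltac:(lia); apply/negP => /and3P[+ _ _].
  move: hk hi hi1; rewrite /straddles /side.
  by case: b {hu hv au av} => /=; lia.
have -> : (i.+1 < size u) = false by lia. have -> : (j < size u) = false by lia.
rewrite subSn //; apply: av; lia.
Qed.

Section Top.

Variables (b : bool) (m : nat) (L R : seq nat).
Hypotheses (Lm : all (ltn^~ m) L) (Rm : all (ltn^~ m) R).

Lemma avoids_unstraddled (c : nat) :
  avoids b (L ++ m :: R) -> c \in R -> unstraddled b c L.
Proof.
move=> h cR; apply/(sortedP 0) => i hi.
have kR : index c R < size R by rewrite index_mem.
have Ec : nth 0 (L ++ m :: R) (size L + (index c R).+1) = c.
  by rewrite nth_cat ltnNge leq_addr /= addKn /= nth_index.
have := h i (size L) (size L + (index c R).+1) hi.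
rewrite Ec !nth_cat hi (ltnW hi) ltnn subnn size_cat /=.
have /= -> := all_nthP 0 Lm i (ltnW hi); have /= -> := all_nthP 0 Lm i.+1 hi.
by rewrite !andbT; apply; lia.
Qed.

(** The letter [m] can only play the 4. So an occurrence lies in [L], lies in [R], or has its
    adjacent pair in [L] and its 2 in [R]; [unstraddled] excludes the last case. *)
Lemma avoids_top : avoids b L -> avoids b R ->
  {in R, forall c, unstraddled b c L} -> avoids b (L ++ m :: R).
Proof.
move=> aL aR h i j k ij jk; rewrite size_cat /= => ks.
have le t : t < size L + (size R).+1 -> nth 0 (L ++ m :: R) t <= m.
  move=> ts; have : nth 0 (L ++ m :: R) t \in L ++ m :: R.
    by rewrite mem_nth // size_cat.
  rewrite mem_cat inE => /or3P[/(allP Lm)/=|/eqP->|/(allP Rm)/=]; lia.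
have nm : nth 0 (L ++ m :: R) (size L) = m by rewrite nth_cat ltnn subnn.
case: (ltngtP k (size L)) => kL.
- have iL : i < size L by lia. have i1L : i.+1 < size L by lia.
  have jL : j < size L by lia.
  by rewrite !nth_cat kL iL i1L jL; apply: aL.
- case: (ltngtP i (size L)) => iL.
  + case: (ltngtP i.+1 (size L)) => i1L; first last.
    * rewrite i1L nm; have := le j; lia.
    * lia.
    * rewrite !nth_cat iL i1L [k < _]ltnNge (ltnW kL) /=.
      (* The successor form lets [nth] step over the leading [m] into [R]. *)
      have -> : k - size L = (k - size L).-1.+1 by lia.
      have kR : (k - size L).-1 < size R by lia.
      have /(sortedP 0)/(_ _ i1L) := h _ (mem_nth 0 kR).
      by move/negbTE => /= ->.
  + rewrite !nth_cat !ltnNge (ltnW kL) (ltnW iL) (ltnW (leqW iL)).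
    have -> /= : size L <= j by lia.
    have -> : k - size L = (k - size L).-1.+1 by lia.
    have -> : j - size L = (j - size L).-1.+1 by lia.
    have -> : i.+1 - size L = (i - size L).-1.+2 by lia.
    have -> : i - size L = (i - size L).-1.+1 by lia.
    by rewrite /= -!ltnNge; apply: aR; lia.
  + by rewrite iL nm; have := le j; lia.
- rewrite kL nm; have := le i ltac:(lia); have := le i.+1 ltac:(lia).
  by rewrite /straddles /side; case: (b) => /=; lia.
Qed.

End Top.

(** * The transformation of words and its inverse *)

(* The letters of [R] cut [L] into blocks of letters not separated by [R]; the
   transformed blocks are put in increasing order of values if [b] holds, and
   in decreasing order otherwise. *)
Fixpoint regroup (f : seq nat -> seq nat) (b : bool) (R L : seq nat) :=
  if R is c :: R' then
    regroup f b R' (filter (side b c) L) ++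
    regroup f b R' (filter (side (~~ b) c) L)
  else f L.

(* [n] is fuel: the value is meaningful only if [size w <= n]. *)
Fixpoint transform (n : nat) (b : bool) (w : seq nat) : seq nat :=
  if n is n'.+1 then
    let m := \max_(x <- w) x in
    let L := take (index m w) w in
    let R := drop (index m w).+1 w in
    if w is [::] then [::] else
    regroup (transform n' b) b (sort leq R) L ++ m :: transform n' b R
  else [::].

Definition flips (b : bool) (g g' : seq nat -> seq nat) (w : seq nat) :=
  [/\ perm_eq (g w) w, avoids (~~ b) (g w) & g' (g w) = w].

Lemma filter_cat_side (b : bool) (c : nat) (u v : seq nat) :
    all (side b c) u -> all (side (~~ b) c) v ->
  filter (side b c) (u ++ v) = u /\ filter (side (~~ b) c) (u ++ v) = v.
Proof.
move=> hu hv; rewrite !filter_cat (all_filterP hu) (all_filterP hv).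
have -> : filter (side b c) v = [::].
  by apply/eqP; rewrite -(negbK (_ == _)) -has_filter -all_predC;
     apply: sub_all hv => x /sideNF /= ->.
have -> : filter (side (~~ b) c) u = [::].
  apply/eqP; rewrite -(negbK (_ == _)) -has_filter -all_predC.
  by apply: sub_all hu => x; rewrite -{1}(negbK b) => /sideNF /= ->.
by rewrite cats0.
Qed.

(** The cut at [c] swaps the two halves of [L]; cutting the result at [c] with the opposite side
    swaps them back. The second claim is what [avoids_top] will ask of the new word. *)
Lemma regroup_flips (b : bool) (f f' : seq nat -> seq nat) (R L : seq nat) :
    (forall u, subseq u L -> avoids b u -> flips b f f' u) ->
    {in R, forall c, c \notin L} -> {in R, forall c, unstraddled b c L} ->
    avoids b L ->
  flips b (regroup f b R) (regroup f' (~~ b) R) L /\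
  {in R, forall c, unstraddled (~~ b) c (regroup f b R L)}.
Proof.
elim: R L => [|c R IH] L hf hL hc aL; first by split=> //; apply: hf.
have cR : c \in c :: R by exact: mem_head.
have E := unstraddledE (hL c cR) (hc c cR).
(* The names fit [b = true]; for [b = false] the letters of [lo] are the larger ones. *)
set lo := filter (side b c) L; set hi := filter (side (~~ b) c) L.
rewrite -/lo -/hi in E.
have alo : all (side b c) lo by exact: filter_all.
have ahi : all (side (~~ b) c) hi by exact: filter_all.
have sub u : subseq u L -> {in R, forall d, d \notin u}.
  move=> uL d dR; apply: contra (hL d _); last by rewrite inE dR orbT.
  exact: mem_subseq uL d.
have hR d : d \in R -> unstraddled b d hi && unstraddled b d lo.
  by move=> dR; rewrite -(unstraddled_cat _ ahi alo) -E hc // inE dR orbT.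
have slo : subseq lo L by exact: filter_subseq.
have shi : subseq hi L by exact: filter_subseq.
have [[p1 a1 i1] u1] := IH lo (fun u su => hf u (subseq_trans su slo))
  (sub _ slo) (fun d dR => proj2 (andP (hR d dR))) ltac:(by rewrite E in aL; exact: avoids_catr aL).
have [[p2 a2 i2] u2] := IH hi (fun u su => hf u (subseq_trans su shi))
  (sub _ shi) (fun d dR => proj1 (andP (hR d dR))) ltac:(by rewrite E in aL; exact: avoids_catl aL).
(* The transformed halves keep their letters, hence their sides of [c]. *)
rewrite -(perm_all _ p1) in alo; rewrite -(perm_all _ p2) in ahi.
split; last first.
  move=> d; rewrite inE /= -/lo -/hi => /predU1P dR.
  rewrite (@unstraddled_cat _ c) ?negbK //.
  case: dR => [->|dR]; last by rewrite u1 // u2.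
  by rewrite (all_unstraddled _ alo) (all_unstraddled _ ahi).
split=> /=; rewrite -/lo -/hi.
- by rewrite [X in perm_eq _ X]E perm_sym perm_catC perm_sym perm_cat.
- by apply: avoids_cat a1 a2; rewrite ?negbK //; eassumption.
- have [f1 f2] := filter_cat_side alo ahi.
  by rewrite negbK f1 f2 i1 i2 -E.
Qed.

Lemma transform_top (n : nat) (b : bool) (m : nat) (L R : seq nat) :
    all (ltn^~ m) L -> all (ltn^~ m) R ->
  transform n.+1 b (L ++ m :: R) =
  regroup (transform n b) b (sort leq R) L ++ m :: transform n b R.
Proof.
move=> Lm Rm; rewrite /=.
have -> : \max_(x <- L ++ m :: R) x = m.
  apply/eqP; rewrite eqn_leq; apply/andP; split; last first.
    by apply: (@leq_bigmax_seq _ _ xpredT id m); rewrite // mem_cat mem_head orbT.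
  apply/bigmax_leqP_seq => x + _; rewrite mem_cat inE.
  by move=> /or3P[/(allP Lm)/=|/eqP->|/(allP Rm)/=]; lia.
have mL : m \notin L by apply/negP => /(allP Lm) /=; rewrite ltnn.
rewrite index_cat (negbTE mL) /= eqxx addn0 take_size_cat //.
rewrite drop_cat ltnNge leqnSn /= subSnn /= drop0.
(* The test for the empty word reduces once the shape of [L] is known. *)
by case: L {Lm mL}.
Qed.

Lemma split_max (w : seq nat) : uniq w -> w != [::] ->
  exists m L R, [/\ w = L ++ m :: R, all (ltn^~ m) L & all (ltn^~ m) R].
Proof.
move=> uw w0; pose m := \max_(x <- w) x.
have mw : m \in w.
  rewrite /m; elim: w w0 {uw m} => [//|x w IH] _; rewrite big_cons inE.
  case: w IH => [_|y w /(_ isT) h]; first by rewrite big_nil maxn0 eqxx.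
  by case: leqP => _; rewrite ?eqxx ?h ?orbT.
have le x : x \in w -> x <= m by move=> xw; apply: (@leq_bigmax_seq _ _ xpredT id x).
clearbody m; case/splitPr: mw uw le => L R; rewrite uniq_catC /= => /andP[mLR _] le.
exists m, L, R; split=> //; apply/allP => x xs /=;
  rewrite ltn_neqAle le ?mem_cat ?inE ?xs ?orbT // andbT;
  by apply: contraNneq mLR => <-; rewrite mem_cat xs ?orbT.
Qed.

(** Removing the maximum leaves enough fuel for [R] and for every block, a subsequence of [L]. *)
Lemma transform_flips (n : nat) (b : bool) (w : seq nat) :
    uniq w -> size w <= n -> avoids b w ->
  flips b (transform n b) (transform n (~~ b)) w /\
  last 0 (transform n b w) = last 0 w.
Proof.
elim: n b w => [|n IH] b w uw.
  by rewrite leqn0 size_eq0 => /eqP-> _.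
case: (eqVneq w [::]) => [-> _ _|w0]; first by [].
have [m [L [R [Ew Lm Rm]]]] := split_max uw w0; rewrite {}Ew in uw w0 *.
rewrite size_cat [size (_ :: _)]/= addnS ltnS => sw aw.
have aL := avoids_catl aw.
have aR : avoids b R by move: aw; rewrite -cat_rcons; exact: avoids_catr.
move: (uw); rewrite cat_uniq => /and3P[uL + /andP[_ uR]].
rewrite negb_or => /andP[_ /hasPn LR].
have [[pR tR iR] lR] := IH b R uR ltac:(lia) aR.
have [[pL tL iL] uLR] : flips b (regroup (transform n b) b (sort leq R))
    (regroup (transform n (~~ b)) (~~ b) (sort leq R)) L /\
  {in sort leq R, forall c,
    unstraddled (~~ b) c (regroup (transform n b) b (sort leq R) L)}.
  apply: regroup_flips => // [u su au|c|c].
  - have un := leq_trans (size_subseq su) (leq_trans (leq_addr _ _) sw).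
    by case: (IH b u (subseq_uniq su uL) un au).
  - by rewrite mem_sort => /LR.
  - by rewrite mem_sort => /(avoids_unstraddled Lm Rm aw).
have E := transform_top n b Lm Rm.
set L' := regroup _ _ _ L in E pL tL iL uLR.
set R' := transform n b R in E pR tR iR lR.
have Lm' : all (ltn^~ m) L' by rewrite (perm_all _ pL).
have Rm' : all (ltn^~ m) R' by rewrite (perm_all _ pR).
split; last first.
  (* [R] and [R'] are empty together, and then both words end in [m]; otherwise [lR] applies. *)
  rewrite E !last_cat [LHS]/= [RHS]/=; case: (R) (pR) lR => [|y s] pRs.
    by move/perm_nilP: pRs => ->.
  by case: (R') pRs => [/perm_size|].
split; rewrite E.
- by rewrite perm_cat // perm_cons.
- apply: avoids_top => // c; rewrite (perm_mem pR) => cR.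
  by apply: uLR; rewrite mem_sort.
- rewrite transform_top // iR.
  (* Sorting makes the cuts independent of the order of [R], so the inverse uses the same cuts. *)
  have -> : sort leq R' = sort leq R.
    by apply/(perm_sortP leq_total leq_trans anti_leq).
  by rewrite iL.
Qed.

(** * Permutations as words, and counting *)

Section Words.

Variable n : nat.

Definition word (pi : 'S_n) : seq nat := [seq val (pi i) | i <- enum 'I_n].

Lemma size_word (pi : 'S_n) : size (word pi) = n.
Proof. by rewrite size_map size_enum_ord. Qed.

Lemma nth_word (pi : 'S_n) (i : 'I_n) : nth 0 (word pi) i = pi i.
Proof. by rewrite (nth_map i) ?size_enum_ord // nth_ord_enum. Qed.

Lemma word_inj : injective word.
Proof.
by move=> s t E; apply/permP => i; apply: val_inj; rewrite /= -!nth_word E.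
Qed.

Lemma perm_word (pi : 'S_n) : perm_eq (word pi) (iota 0 n).
Proof.
apply: uniq_perm (iota_uniq _ _) _.
  by rewrite map_inj_uniq ?enum_uniq // => i j /val_inj /perm_inj.
move=> x; rewrite mem_iota /=; apply/mapP/idP => [[i _ ->]|xn]; first exact: ltn_ord.
by exists (pi^-1%g (Ordinal xn)); rewrite ?mem_enum // permKV.
Qed.

Lemma uniq_word (pi : 'S_n) : uniq (word pi).
Proof. by rewrite (perm_uniq (perm_word pi)) iota_uniq. Qed.

Lemma word_surj (w : seq nat) : perm_eq w (iota 0 n) -> exists pi, word pi = w.
Proof.
move=> pw; have sw : size w = n by rewrite (perm_size pw) size_iota.
have ltn_w (i : 'I_n) : nth 0 w i < n.
  have : nth 0 w i \in w by rewrite mem_nth // sw.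
  by rewrite (perm_mem pw) mem_iota.
have inj : injective (fun i => Ordinal (ltn_w i)).
  move=> i j [] /eqP; rewrite nth_uniq ?sw // ?(perm_uniq pw) ?iota_uniq //.
  by move/eqP/val_inj.
exists (perm inj); apply: (@eq_from_nth _ 0) => [|i]; rewrite size_word ?sw // => i_n.
by rewrite (nth_word _ (Ordinal i_n)) permE.
Qed.

Variables (p q : vincular) (b : bool).
Hypothesis pP : forall pi : 'S_n, pi \in avoiders p n <-> avoids b (word pi).
Hypothesis qP : forall pi : 'S_n, pi \in avoiders q n <-> avoids (~~ b) (word pi).

(** [transform] is injective on avoiders because the opposite [transform] undoes it. Exchanging [p]
    and [q] will give the reverse inequality; [P] covers both the full count and a prescribed last
    letter. *)
Lemma leq_card_avoiders (P : pred nat) :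
  #|[set pi in avoiders p n | P (last 0 (word pi))]| <=
  #|[set pi in avoiders q n | P (last 0 (word pi))]|.
Proof.
(* The default [pi] is never taken on avoiders, by [word_surj]. *)
pose F (pi : 'S_n) := odflt pi [pick s | word s == transform n b (word pi)].
have FE pi : pi \in avoiders p n ->
  word (F pi) = transform n b (word pi) /\
  flips b (transform n b) (transform n (~~ b)) (word pi) /\
  last 0 (transform n b (word pi)) = last 0 (word pi).
  move=> /pP a.
  have [fl l] := transform_flips (uniq_word pi) (eq_leq (size_word pi)) a.
  split=> //; rewrite /F; case: pickP => [s /eqP //|no].
  have [pe _ _] := fl; have [s sE] := word_surj (perm_trans pe (perm_word pi)).
  by have := no s; rewrite sE eqxx.
rewrite -(@card_in_imset _ _ F).
  apply/subset_leq_card/subsetP => _ /imsetP[pi /setIdP[a l] ->].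
  have [E [[_ ? _] El]] := FE pi a.
  by rewrite inE E El l andbT; apply/qP; rewrite E.
move=> s t /setIdP[/FE[Es [[_ _ is1] _]] _] /setIdP[/FE[Et [[_ _ it1] _]] _] E.
by apply: word_inj; rewrite -is1 -it1 -Es -Et E.
Qed.

End Words.

(** * The two vincular patterns as conditions on words *)

Lemma contains_last_two_gaps (s : 'S_4) (n : nat) (pi : 'S_n) :
  contains (@Vincular 4 s last_two_gaps) pi <->
  exists x y z t : 'I_n, [/\ y = x.+1 :> nat, y < z, z < t &
    forall j k : 'I_4, (s j < s k) =
      (nth 0 [:: pi x : nat; pi y : nat; pi z : nat; pi t : nat] j <
       nth 0 [:: pi x : nat; pi y : nat; pi z : nat; pi t : nat] k)].
Proof.
split=> [/existsP[i /and3P[/forallP incr /forallP iso /forallP adj]]|].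
  have lt01 := implyP (forallP (incr (@Ordinal 4 1 isT)) (@Ordinal 4 2 isT)) isT.
  have lt12 := implyP (forallP (incr (@Ordinal 4 2 isT)) (@Ordinal 4 3 isT)) isT.
  have := forallP (forallP (adj (@Ordinal 3 0 isT)) (@Ordinal 4 0 isT)) (@Ordinal 4 1 isT).
  rewrite /= !inE /= => /eqP yx.
  exists (i (@Ordinal 4 0 isT)), (i (@Ordinal 4 1 isT)),
    (i (@Ordinal 4 2 isT)), (i (@Ordinal 4 3 isT)); split=> // j k.
  have nthE (l : 'I_4) : nth 0 [:: pi (i (@Ordinal 4 0 isT)) : nat;
      pi (i (@Ordinal 4 1 isT)) : nat; pi (i (@Ordinal 4 2 isT)) : nat;
      pi (i (@Ordinal 4 3 isT)) : nat] l = pi (i l).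
    by case: l => [[|[|[|[|//]]]] hl] /=; congr (nat_of_ord (pi (i _))); apply: val_inj.
  by rewrite !nthE (eqP (forallP (iso j) k)).
move=> [x [y [z [t [yx yz zt iso]]]]].
apply/existsP; exists [ffun l : 'I_4 => nth x [:: x; y; z; t] l].
apply/and3P; split.
- apply/forallP => j; apply/forallP => k; rewrite !ffunE; apply/implyP.
  by case: j => [[|[|[|[|//]]]] hj]; case: k => [[|[|[|[|//]]]] hk] /=; lia.
- apply/forallP => j; apply/forallP => k; rewrite !ffunE /= iso; apply/eqP.
  by case: j => [[|[|[|[|//]]]] hj]; case: k => [[|[|[|[|//]]]] hk].
- apply/forallP => g; apply/forallP => j; apply/forallP => k; rewrite !ffunE !inE.
  apply/implyP => /and3P[+ /eqP Ej /eqP Ek]; rewrite Ej Ek.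
  by case: g {Ej Ek} => [[|[|[|//]]] hg] //= _; apply/eqP.
Qed.

(** The hypothesis isolates what depends on the pattern: a comparison of four values. *)
Lemma avoiders_last_two_gaps (s : 'S_4) (b : bool) (n : nat) (pi : 'S_n) :
    (forall f : 'I_4 -> nat,
       (forall j k, (s j < s k) = (f j < f k)) <->
       [&& straddles b (f (inord 3)) (f (inord 0)) (f (inord 1)),
           f (inord 0) < f (inord 2) & f (inord 1) < f (inord 2)]) ->
  pi \in avoiders (@Vincular 4 s last_two_gaps) n <-> avoids b (word pi).
Proof.
move=> sP; rewrite inE; split.
  move=> nc i j k ij jk; rewrite size_word => kn; apply: contra nc => h.
  apply/contains_last_two_gaps.
  have jn := ltn_trans jk kn; have i1n := ltn_trans ij jn; have i_n := ltnW i1n.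
  exists (Ordinal i_n), (Ordinal i1n), (Ordinal jn), (Ordinal kn); split=> //.
  apply/(sP (fun l : 'I_4 => nth 0 _ l)); rewrite !inordK //=.
  by rewrite -!nth_word.
move=> a; apply/negP => /contains_last_two_gaps[x [y [z [t [yx yz zt]]]]].
move/(sP (fun l : 'I_4 => nth 0 _ l)); rewrite !inordK //= -!nth_word yx => h.
by have := a x z t; rewrite -yx yz zt size_word ltn_ord yx h => /(_ isT isT isT).
Qed.

Lemma ord4_nth (f : 'I_4 -> nat) (l : 'I_4) :
  f l = nth 0 [:: f (inord 0); f (inord 1); f (inord 2); f (inord 3)] l.
Proof.
by case: l => [[|[|[|[|//]]]] hl] /=; congr f; apply: val_inj; rewrite /= inordK.
Qed.

Lemma avoiders_13_4_2 (n : nat) (pi : 'S_n) :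
  pi \in avoiders pattern_13_4_2 n <-> avoids true (word pi).
Proof.
apply: avoiders_last_two_gaps => f; split=> [h|h j k].
  (* The positions of 1, 2, 3, 4 in 1342 are 0, 3, 1, 2; consecutive values suffice. *)
  have := h (inord 0) (inord 3); have := h (inord 3) (inord 1).
  have := h (inord 1) (inord 2).
  rewrite !permE !(tnth_nth (inord 0)) !inordK //= /straddles /side /=; lia.
rewrite (ord4_nth f j) (ord4_nth f k) !permE !(tnth_nth (inord 0)).
move: h; rewrite /straddles /side /=.
by case: j => [[|[|[|[|//]]]] hj]; case: k => [[|[|[|[|//]]]] hk] /=; lia.
Qed.

Lemma avoiders_31_4_2 (n : nat) (pi : 'S_n) :
  pi \in avoiders pattern_31_4_2 n <-> avoids false (word pi).
Proof.
apply: avoiders_last_two_gaps => f; split=> [h|h j k].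
  (* In 3142 the positions of 1, 2, 3, 4 are 1, 3, 0, 2. *)
  have := h (inord 1) (inord 3); have := h (inord 3) (inord 0).
  have := h (inord 0) (inord 2).
  rewrite !permE !(tnth_nth (inord 0)) !inordK //= /straddles /side /=; lia.
rewrite (ord4_nth f j) (ord4_nth f k) !permE !(tnth_nth (inord 0)).
move: h; rewrite /straddles /side /=.
by case: j => [[|[|[|[|//]]]] hj]; case: k => [[|[|[|[|//]]]] hk] /=; lia.
Qed.

Lemma last_word (n : nat) (pi : 'S_n.+1) : last 0 (word pi) = pi ord_max.
Proof. by rewrite -nth_last size_word -[n.+1.-1]/(val (@ord_max n)) nth_word. Qed.

Theorem theorem5p3 :
  wilf_equivalent pattern_13_4_2 pattern_31_4_2 /\
  (forall (n : nat) (a : 'I_n.+1),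
     #|[set pi in avoiders pattern_13_4_2 n.+1 | pi ord_max == a]| =
     #|[set pi in avoiders pattern_31_4_2 n.+1 | pi ord_max == a]|).
Proof.
have card_eq n (P : pred nat) :
    #|[set pi in avoiders pattern_13_4_2 n | P (last 0 (word pi))]| =
    #|[set pi in avoiders pattern_31_4_2 n | P (last 0 (word pi))]|.
  apply/eqP; rewrite eqn_leq; apply/andP; split.
    by apply: (@leq_card_avoiders _ _ _ true); [exact: avoiders_13_4_2 | exact: avoiders_31_4_2].
  by apply: (@leq_card_avoiders _ _ _ false); [exact: avoiders_31_4_2 | exact: avoiders_13_4_2].
split=> [n|n a].
  have E p : [set pi in avoiders p n | xpredT (last 0 (word pi))] = avoiders p n.
    by apply/setP => pi; rewrite !inE andbT.
  by rewrite -(E pattern_13_4_2) -(E pattern_31_4_2); exact: (card_eq n xpredT).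
have := card_eq n.+1 (pred1 (a : nat)).
have E p : [set pi in avoiders p n.+1 | pred1 (a : nat) (last 0 (word pi))] =
    [set pi in avoiders p n.+1 | pi ord_max == a].
  by apply/setP => pi; rewrite !inE last_word.
by rewrite !E.
Qed.
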